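(* There exists a mono-monostatic polygonal $0$-skeleton with exactly $11$ vertices, i.e. a convex polygon in $\mathbb{R}^2$ with $11$ vertices which, when equipped with equal point masses at its vertices, is mono-monostatic.
   Context: A polygonal $0$-skeleton is a convex polygon $P\subset\mathbb{R}^2$ (with nonempty interior) whose mass distribution consists of equal point masses at its vertices; its center of mass $c$ is the arithmetic mean of its vertices. A point $q\in\mathrm{bd}\,P$ is an equilibrium point of $P$ (with respect to $c$) if the line $H$ through $q$ perpendicular to the segment $[c,q]$ supports $P$ at $q$. It is nondegenerate if $H\cap P$ is the unique vertex or edge of $P$ that contains $q$ in its relative interior. A nondegenerate equilibrium point is stable if $\dim(H\cap P)=1$ (so it lies in the interior of an edge) and unstable if $\dim(H\cap P)=0$ (so it is a vertex). Only polygons all of whose equilibrium points with respect to the center of mass are nondegenerate are considered. Such a polygon is mono-monostatic if it has exactly one stable and exactly one unstable equilibrium point. *)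

(* Defs.v *)
From HB Require Import structures.
From mathcomp Require Import all_boot all_order all_algebra.
From mathcomp Require Import all_classical all_reals all_analysis.

Set Implicit Arguments.
Unset Strict Implicit.
Unset Printing Implicit Defensive.

Import Order.TTheory GRing.Theory Num.Theory.
Import numFieldNormedType.Exports.

Local Open Scope classical_set_scope.
Local Open Scope ring_scope.

Section PlaneConvexity.
Context {R : realType}.
Local Notation plane := 'rV[R]_2.
Implicit Types (A P F : set plane) (q u c : plane).

Definition dot (x y : plane) : R := \sum_(i < 2) x 0 i * y 0 i.

Definition conv_hull A : set plane :=
  smallest (@convex_set R plane) A.

(* Nonempty affine subspaces; the direction space is the row space of U. *)
Definition affine_subspace A : Prop :=
  exists (p : plane) (U : 'M[R]_2), A = [set x | (x - p <= U)%MS].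

Definition affine_hull A : set plane := smallest affine_subspace A.

Definition has_dim A (d : nat) : Prop :=
  exists (p : plane) (U : 'M[R]_2),
    \rank U = d /\ affine_hull A = [set x | (x - p <= U)%MS].

Definition relative_interior A : set plane :=
  [set q | A q /\ \forall x \near q, affine_hull A x -> A x].

Definition boundary A : set plane := closure A `\` interior A.

(* The line through q with normal vector u; a line only when u != 0. *)
Definition line q u : set plane := [set x | dot u (x - q) = 0].

Definition supports_at P q u : Prop :=
  [/\ u != 0, P q &
      (forall x, P x -> dot u (x - q) <= 0) \/
      (forall x, P x -> 0 <= dot u (x - q))].

Definition face P (d : nat) F : Prop :=
  has_dim F d /\
  exists q u, supports_at P q u /\ F = line q u `&` P.

Definition vertices P : set plane := [set v | face P 0 [set v]].

Definition vertex_or_edge P F : Prop := face P 0 F \/ face P 1 F.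

Definition convex_polygon n P (v : 'I_n -> plane) : Prop :=
  [/\ P = conv_hull (range v), interior P !=set0,
      injective v & vertices P = range v].

Definition vertex_mean n (v : 'I_n -> plane) : plane :=
  n%:R^-1 *: \sum_(i < n) v i.

(* The line through q perpendicular to the segment [c, q] has normal q - c. *)
Definition equilibrium P c q : Prop :=
  boundary P q /\ supports_at P q (q - c).

Definition nondegenerate P c q : Prop :=
  [set F | vertex_or_edge P F /\ relative_interior F q]
    = [set line q (q - c) `&` P].

Definition stable P c q : Prop :=
  [/\ equilibrium P c q, nondegenerate P c q &
      has_dim (line q (q - c) `&` P) 1].

Definition unstable P c q : Prop :=
  [/\ equilibrium P c q, nondegenerate P c q &
      has_dim (line q (q - c) `&` P) 0].

Definition mono_monostatic P c : Prop :=
  [/\ forall q, equilibrium P c q -> nondegenerate P c q,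
      exists! q, stable P c q &
      exists! q, unstable P c q].

End PlaneConvexity.

(* Main.v *)
(* The distance from the center of mass to the boundary of the 11-gon below
   decreases strictly from one top vertex along both sides down to one bottom
   edge. A boundary point q is an equilibrium exactly when it maximizes the
   functional <q, .> over the polygon; by strict convexity q is then a vertex or
   a foot of the perpendicular from the center inside an edge, and monotonicity
   of the distance leaves only the top vertex and the midpoint of the bottom
   edge. The explicit 11-gon has integer vertices summing to zero, so all
   remaining conditions are finitely many integer inequalities. *)
Require Import Defs.
From mathcomp Require Import all_boot all_order all_algebra.
From mathcomp Require Import all_classical all_reals all_analysis.
From mathcomp Require Import zify ring lra.

Import Order.TTheory GRing.Theory Num.Theory.
Import numFieldNormedType.Exports.

Local Open Scope classical_set_scope.
Local Open Scope ring_scope.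

Set Implicit Arguments.
Unset Strict Implicit.
Unset Printing Implicit Defensive.

(** * Plane coordinates: dot product, determinant, continuity of linear functionals *)

Section DotProduct.
Context {R : realType}.
Local Notation plane := 'rV[R]_2.
Implicit Types (x y z u : plane).

Lemma dotE x y : dot x y = x 0 0 * y 0 0 + x 0 1 * y 0 1.
Proof.
by rewrite /dot !big_ord_recl big_ord0 addr0; congr (_ + x 0 _ * y 0 _); apply/val_inj.
Qed.

(** The determinant of the pair; its sign gives the orientation. *)
Definition cross x y : R := x 0 0 * y 0 1 - x 0 1 * y 0 0.

Definition perp x : plane := \row_(i < 2) if i == 0 then - x 0 1 else x 0 0.

Lemma dot_perp x y : dot (perp x) y = cross x y.
Proof. by rewrite dotE !mxE /cross /=; ring. Qed.

Lemma plane_ext x y : x 0 0 = y 0 0 -> x 0 1 = y 0 1 -> x = y.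
Proof.
move=> e0 e1; apply/rowP => i; case: (unliftP 0 i) => [j|] -> //.
by rewrite (ord1 j); move: e1; congr (x 0 _ = y 0 _); apply/val_inj.
Qed.

Lemma dotDr u x y : dot u (x + y) = dot u x + dot u y.
Proof. by rewrite !dotE !mxE; ring. Qed.

Lemma dotBr u x y : dot u (x - y) = dot u x - dot u y.
Proof. by rewrite !dotE !mxE; ring. Qed.

Lemma dotZr u (a : R) x : dot u (a *: x) = a * dot u x.
Proof. by rewrite !dotE !mxE; ring. Qed.

Lemma dotNl x y : dot (- x) y = - dot x y.
Proof. by rewrite !dotE !mxE; ring. Qed.

Lemma dotC x y : dot x y = dot y x.
Proof. by rewrite !dotE; ring. Qed.

Lemma dot0l x : dot 0 x = 0.
Proof. by rewrite dotE !mxE; ring. Qed.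

Lemma dot0r x : dot x 0 = 0.
Proof. by rewrite dotC dot0l. Qed.

Lemma dot_sumr u n (f : 'I_n -> plane) :
  dot u (\sum_(i < n) f i) = \sum_(i < n) dot u (f i).
Proof. exact: (big_morph _ (dotDr u) (dot0r u)). Qed.

Lemma dot_gt0 x : x != 0 -> 0 < dot x x.
Proof.
move=> x0; rewrite lt_neqAle dotE -!expr2 addr_ge0 ?sqr_ge0// andbT eq_sym.
apply: contra x0; rewrite paddr_eq0 ?sqr_ge0// !sqrf_eq0 => /andP[/eqP a /eqP b].
by apply/eqP/plane_ext; rewrite mxE.
Qed.

(** Cramer's rule: [cross x y] is the determinant of the linear system for the coordinates of
    [q]. *)
Lemma dot_ortho_eq0 q x y :
  cross x y != 0 -> dot q x = 0 -> dot q y = 0 -> q = 0.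
Proof.
rewrite !dotE => xy qx qy.
have q0 : cross x y * q 0 0 = 0.
  have -> : cross x y * q 0 0 = y 0 1 * (q 0 0 * x 0 0 + q 0 1 * x 0 1)
    - x 0 1 * (q 0 0 * y 0 0 + q 0 1 * y 0 1) by rewrite /cross; ring.
  by rewrite qx qy !mulr0 subr0.
have q1 : cross x y * q 0 1 = 0.
  have -> : cross x y * q 0 1 = x 0 0 * (q 0 0 * y 0 0 + q 0 1 * y 0 1)
    - y 0 0 * (q 0 0 * x 0 0 + q 0 1 * x 0 1) by rewrite /cross; ring.
  by rewrite qx qy !mulr0 subr0.
by apply: plane_ext; rewrite mxE; apply: (mulfI xy); rewrite mulr0.
Qed.

(** In the plane the vectors orthogonal to [q] form a line, spanned by [x]; the coefficient is that
    of the orthogonal projection. *)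
Lemma ortho_scale q x y : q != 0 -> x != 0 -> dot q x = 0 -> dot q y = 0 ->
  y = (dot x y / dot x x) *: x.
Proof.
move=> q0 x0 qx qy; have xx := dot_gt0 x0.
have xy : cross x y = 0.
  by apply: contra_neq_eq q0 => xy; exact: dot_ortho_eq0 xy qx qy.
apply: (scalerI (lt0r_neq0 xx)); rewrite scalerA mulrCA divff ?lt0r_neq0// mulr1.
move: xy; rewrite /cross !dotE => xy.
apply: plane_ext; rewrite !mxE; apply/eqP; rewrite -subr_eq0; apply/eqP.
  by rewrite -(mulr0 (- x 0 1)) -xy; ring.
by rewrite -(mulr0 (x 0 0)) -xy; ring.
Qed.

Lemma dot_continuous u : continuous (dot u : plane -> R).
Proof.
move=> x; rewrite (_ : dot u = fun y => u 0 0 * y 0 0 + u 0 1 * y 0 1); last first.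
  by apply/funext => y; rewrite dotE.
have c i : (fun y : plane => u 0 i * y 0 i) @ x --> u 0 i * x 0 i.
  exact: (@cvgMl_tmp R plane (nbhs x) _ _ (u 0 i) _ (@coord_continuous R 1 2 0 i x)).
exact: (@cvgD R R^o _ _ _ _ _ _ _ (c 0) (c 1)).
Qed.

Lemma near_dot_gt (u q : plane) (k : R) : k < dot u q -> \forall x \near q, k < dot u x.
Proof. by move=> kq; apply: (cvgr_gt _ (@dot_continuous u q)). Qed.

(** Supplies a point pushed strictly past [q], for the arguments on boundary and relative
    interior. *)
Lemma near_ray (q u : plane) (A : set plane) :
  nbhs q A -> exists2 e : R, 0 < e & A (q + e *: u).
Proof.
move=> Aq.
have lim : (fun e : R => q + e *: u) @ 0^'+ --> q.
  apply: cvg_at_right_filter; rewrite -[X in _ --> X]addr0 -(scale0r u).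
  by apply: cvgD; [exact: cvg_cst|apply: cvgZr_tmp; exact: cvg_id].
have : \forall e \near (0 : R)^'+, 0 < e /\ A (q + e *: u).
  by apply: filterI; [exact: nbhs_right_gt|exact: lim].
by move=> /filter_ex[e []]; exists e.
Qed.

End DotProduct.

(** * Affine hulls and dimension *)

Section AffineHull.
Context {R : realType}.
Local Notation plane := 'rV[R]_2.
Implicit Types (x y z u p q : plane) (A F : set plane).

Lemma sub_affine_hull A : A `<=` affine_hull A.
Proof. exact: sub_gen_smallest. Qed.

Lemma affine_hull_line A x y (t : R) :
  affine_hull A x -> affine_hull A y -> affine_hull A (x + t *: (y - x)).
Proof.
move=> Ax Ay B [affB AB].
have Bx : B x by exact: (Ax B).
have By : B y by exact: (Ay B).
case: affB Bx By => p [U ->] /= xU yU.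
have -> : x + t *: (y - x) - p = (1 - t) *: (x - p) + t *: (y - p).
  by apply: plane_ext; rewrite !mxE; ring.
by rewrite addmx_sub // scalemx_sub.
Qed.

Lemma affine_hull_sub A p (U : 'M[R]_2) :
  A `<=` [set x | (x - p <= U)%MS] -> affine_hull A `<=` [set x | (x - p <= U)%MS].
Proof. by apply: smallest_sub; exists p, U. Qed.

Lemma affine_hull_set1 q : affine_hull [set q] = [set q].
Proof.
apply/seteqP; split; last exact: sub_affine_hull.
have sub : [set q] `<=` [set x | (x - q <= (0 : 'M[R]_2))%MS].
  by move=> x ->; rewrite /= subrr sub0mx.
move=> x /(affine_hull_sub sub) /=.
by rewrite submx0 subr_eq0 => /eqP.
Qed.

Lemma has_dim_set1 q d : has_dim [set q] d <-> d = 0%N.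
Proof.
split=> [[p [U [<-]]]|->]; last first.
  exists q, 0; split; first exact: mxrank0.
  rewrite affine_hull_set1; apply/seteqP; split => x /=.
    by move=> ->; rewrite subrr sub0mx.
  by rewrite submx0 subr_eq0 => /eqP.
rewrite affine_hull_set1 => /seteqP[_ sub].
have pq : p = q by apply: sub; rewrite /= subrr sub0mx.
(* Translating [p] by any row of [U] stays in the hull, which is one point, so each row vanishes. *)
apply/eqP; rewrite mxrank_eq0; apply/eqP/row_matrixP => i; rewrite row0.
have : p + row i U = q by apply: sub; rewrite /= addrC addKr row_sub.
by rewrite pq => /eqP; rewrite -subr_eq0 addrC addKr => /eqP.
Qed.

Lemma has_dim0_eq A x y : has_dim A 0 -> A x -> A y -> x = y.
Proof.
move=> [p [U [/eqP]]]; rewrite mxrank_eq0 => /eqP-> hA.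
have e z : A z -> z = p.
  move=> /sub_affine_hull; rewrite hA /= submx0 subr_eq0.
  by move/eqP.
by move=> /e-> /e->.
Qed.

End AffineHull.

(** * Convex hulls: weights and interior points *)

Section ConvexHull.
Context {R : realType}.
Local Notation plane := 'rV[R]_2.
Implicit Types (x y u q : plane) (A F : set plane).

Lemma conv_hull_convex A x y (t : R) : 0 <= t -> t <= 1 ->
  conv_hull A x -> conv_hull A y -> conv_hull A (t *: x + (1 - t) *: y).
Proof.
move=> t0 t1 Ax Ay B [cB AB].
have Bx : B x by exact: (Ax B).
have By : B y by exact: (Ay B).
have := cB x y (Itv01 t0 t1).
by rewrite !inE; apply.
Qed.

Lemma conv_hull3 A x y z (a b c : R) : 0 < a -> 0 < b -> 0 < c -> a + b + c = 1 ->
  conv_hull A x -> conv_hull A y -> conv_hull A z ->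
  conv_hull A (a *: x + b *: y + c *: z).
Proof.
move=> a0 b0 c0 abc Ax Ay Az.
have ab0 : 0 < a + b by exact: addr_gt0.
have t0 : 0 <= a / (a + b) by rewrite divr_ge0 ?ltW.
have t1 : a / (a + b) <= 1 by rewrite ler_pdivrMr// mul1r lerDl ltW.
have s0 : 0 <= a + b by exact: ltW.
have s1 : a + b <= 1 by rewrite -abc lerDl ltW.
have := conv_hull_convex s0 s1 (conv_hull_convex t0 t1 Ax Ay) Az.
congr conv_hull.
have -> : c = 1 - (a + b) by rewrite -abc; ring.
by apply: plane_ext; rewrite !mxE; field; rewrite gt_eqF.
Qed.

(** The convex combinations form a convex set containing every [v i], so the smallest such set is
    included in it. *)
Lemma conv_hull_range n (v : 'I_n -> plane) x : conv_hull (range v) x ->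
  exists a : 'I_n -> R,
    [/\ forall i, 0 <= a i, \sum_(i < n) a i = 1 & x = \sum_(i < n) a i *: v i].
Proof.
apply: (@smallest_sub _ _ _ [set x | exists a : 'I_n -> R, [/\ forall i, 0 <= a i,
  \sum_(i < n) a i = 1 & x = \sum_(i < n) a i *: v i]]).
- move=> y z l; rewrite !inE /= => -[a [a0 a1 ->]] [b [b0 b1 ->]].
  exists (fun i => l%:num * a i + (1 - l%:num) * b i); split.
  + by move=> i; rewrite addr_ge0// mulr_ge0// subr_ge0.
  + by rewrite big_split/= -!mulr_sumr a1 b1; ring.
  + rewrite /conv /= !scaler_sumr -big_split/=.
    by apply: eq_bigr => i _; rewrite [RHS]scalerDl !scalerA.
- move=> _ [i _ <-]; exists (fun j => (j == i)%:R); split => [j||].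
  + by rewrite ler0n.
  + by rewrite (bigD1 i)//= eqxx big1 ?addr0// => j /negPf ->.
  + rewrite (bigD1 i)//= eqxx scale1r big1 ?addr0// => j /negPf ->.
    by rewrite scale0r.
Qed.

(** The three barycentric coordinates are affine in the point and equal 1/3 at the centroid, so they
    remain positive near it. *)
Lemma conv_hull_triangle_interior A (x y z : plane) : 0 < cross (y - x) (z - x) ->
  A x -> A y -> A z -> interior (conv_hull A) !=set0.
Proof.
move=> D0 /(@sub_gen_smallest _ (@convex_set R plane)) Ax
  /(@sub_gen_smallest _ (@convex_set R plane)) Ay
  /(@sub_gen_smallest _ (@convex_set R plane)) Az.
set D := cross _ _ in D0.
(* [cross v w + dot (perp (w - v)) p] is twice the signed area of the triangle [v w p]: for an edge
   [v w] of the given triangle, [D] times a barycentric coordinate of [p]. *)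
have near_f (v w g : plane) : 0 < cross v w + dot (perp (w - v)) g ->
    \forall p \near g, 0 < cross v w + dot (perp (w - v)) p.
  move=> h; have : - cross v w < dot (perp (w - v)) g by rewrite -subr_gt0 opprK addrC.
  move=> /near_dot_gt; apply: filterS => p; rewrite -subr_gt0 opprK addrC//.
pose g := 3%:R^-1 *: (x + y + z).
exists g; rewrite /interior /=.
have e (v w u : plane) : D = cross v w + cross w u + cross u v ->
   0 < cross v w + dot (perp (w - v)) (3%:R^-1 *: (u + v + w)).
  move=> De; have -> : cross v w + dot (perp (w - v)) (3%:R^-1 *: (u + v + w)) = D / 3%:R.
    by rewrite De dotE /cross !mxE /=; field.
  by rewrite divr_gt0.
have ex : 0 < cross y z + dot (perp (z - y)) g.
  by apply: e; rewrite /D /cross !mxE; ring.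
have ey : 0 < cross z x + dot (perp (x - z)) g.
  have -> : g = 3%:R^-1 *: (y + z + x) by rewrite /g -addrA addrC.
  by apply: e; rewrite /D /cross !mxE; ring.
have ez : 0 < cross x y + dot (perp (y - x)) g.
  have -> : g = 3%:R^-1 *: (z + x + y) by rewrite /g addrC addrA.
  by apply: e; rewrite /D /cross !mxE; ring.
near=> p.
have px : 0 < cross y z + dot (perp (z - y)) p by near: p; exact: near_f.
have py : 0 < cross z x + dot (perp (x - z)) p by near: p; exact: near_f.
have pz : 0 < cross x y + dot (perp (y - x)) p by near: p; exact: near_f.
have Dn0 : D != 0 by exact: lt0r_neq0.
have -> : p = ((cross y z + dot (perp (z - y)) p) / D) *: x
    + ((cross z x + dot (perp (x - z)) p) / D) *: y
    + ((cross x y + dot (perp (y - x)) p) / D) *: z.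
  rewrite !dot_perp; move: Dn0; rewrite /D /cross !mxE => Dn0.
  by apply: plane_ext; rewrite !mxE; field.
apply: conv_hull3 => //; rewrite ?divr_gt0//.
rewrite !dot_perp -!mulrDl.
by apply: (canLR (mulfK Dn0)); rewrite mul1r /D /cross !mxE; ring.
Unshelve. all: by end_near.
Qed.

End ConvexHull.

(** * Hulls of finitely many points: maxima of linear functionals and exposed vertices *)

Section ConvexPolygon.
Context {R : realType} (n : nat) (v : 'I_n -> 'rV[R]_2).
Local Notation plane := 'rV[R]_2.
Implicit Types (x y u q : plane) (i j k : 'I_n) (a : 'I_n -> R).

Let P := conv_hull (range v).

Lemma vertex_in_hull i : P (v i).
Proof. by apply: sub_gen_smallest; exists i. Qed.

Lemma hull_dot_le u (M : R) x : (forall i, dot u (v i) <= M) -> P x -> dot u x <= M.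
Proof.
move=> uM /conv_hull_range[a [a0 a1 ->]].
rewrite dot_sumr -[M]mul1r -a1 mulr_suml; apply: ler_sum => i _.
by rewrite dotZr ler_wpM2l.
Qed.

(** The slacks [M - dot u (v i)] are nonnegative and their weighted sum is zero, so every slack of
    nonzero weight vanishes. *)
Lemma active_dot u (M : R) a : (forall i, dot u (v i) <= M) ->
  (forall i, 0 <= a i) -> \sum_(i < n) a i = 1 ->
  dot u (\sum_(i < n) a i *: v i) = M ->
  forall i, a i != 0 -> dot u (v i) = M.
Proof.
move=> uM a0 a1 uaM i ai.
have : \sum_(j < n) a j * (M - dot u (v j)) = 0.
  under eq_bigr do rewrite mulrBr.
  rewrite sumrB -mulr_suml a1 mul1r -[X in X - _]uaM dot_sumr -sumrB.
  by rewrite big1// => j _; rewrite dotZr subrr.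
move=> /psumr_eq0P s0.
have /eqP : a i * (M - dot u (v i)) = 0.
  by apply: s0 => // j _; rewrite mulr_ge0// subr_ge0.
by rewrite mulf_eq0 (negPf ai)/= subr_eq0 => /eqP.
Qed.

Lemma sum1_neq0 a : \sum_(i < n) a i = 1 -> exists i, a i != 0.
Proof.
move=> a1; apply/existsP; apply: contraT; rewrite negb_exists => /forallP all0.
have : (1 : R) = 0 by rewrite -a1 big1// => i _; apply/eqP; rewrite -[_ == _]negbK.
by move=> /eqP; rewrite oner_eq0.
Qed.

Lemma sum_weight1 a i : (forall j, j != i -> a j = 0) -> \sum_(j < n) a j = 1 ->
  \sum_(j < n) a j *: v j = v i.
Proof.
move=> ai; rewrite (bigD1 i)//= [X in _ + X]big1// addr0 => a1.
by rewrite (bigD1 i)//= a1 scale1r big1 ?addr0// => j /ai->; rewrite scale0r.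
Qed.

Lemma sum_weight2 a i j : j != i -> (forall k, k != i -> k != j -> a k = 0) ->
  \sum_(k < n) a k = 1 ->
  a j = 1 - a i /\ \sum_(k < n) a k *: v k = a i *: v i + a j *: v j.
Proof.
move=> ji aij; rewrite (bigD1 i)//= (bigD1 j)//= [X in _ + (_ + X)]big1; last first.
  by move=> k /andP[]; exact: aij.
rewrite addr0 => a1; split; first by rewrite -a1 addrAC subrr add0r.
rewrite (bigD1 i)//= (bigD1 j)//= [X in _ + (_ + X)]big1 ?addr0//.
by move=> k /andP[ki kj]; rewrite aij// scale0r.
Qed.

Section Exposed.
Context (i : 'I_n) (u : plane) (ui : forall j, j != i -> dot u (v j - v i) < 0).

Lemma exposed_dot_le j : dot u (v j) <= dot u (v i).
Proof.
have [->//|/ui] := eqVneq j i.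
by rewrite dotBr subr_lt0 => /ltW.
Qed.

(** A point of the hull on this line puts weight only on vertices that maximize [dot u], hence only
    on [v i]. *)
Lemma exposed_line : line (v i) u `&` P = [set v i].
Proof.
apply/seteqP; split => x /=; last first.
  by move=> ->; split; [rewrite /line /= subrr dot0r|exact: vertex_in_hull].
move=> [/eqP]; rewrite dotBr subr_eq0 => /eqP ux /conv_hull_range[a [a0 a1 xa]].
move: ux; rewrite xa => /(active_dot exposed_dot_le a0 a1) act.
apply: sum_weight1 => // j /ui; rewrite dotBr => uj.
by apply: contraTeq uj => /act ->; rewrite subrr ltxx.
Qed.

Lemma exposed_supports : u != 0 -> supports_at P (v i) u.
Proof.
move=> u0; split => //; first exact: vertex_in_hull.
left => x Px; rewrite dotBr subr_le0; apply: hull_dot_le Px; exact: exposed_dot_le.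
Qed.

Lemma exposed_face : u != 0 -> face P 0 [set v i].
Proof.
move=> u0; split; first exact/has_dim_set1.
by exists (v i), u; rewrite exposed_line; split => //; exact: exposed_supports.
Qed.

(** If [x] is in [F], the ray from [x] through [v i] continues a little within [F]. As [dot u] is
    maximal at [v i], it cannot be smaller at [x], so [x] lies on the supporting line, which meets
    the hull in [v i] only. *)
Lemma relative_interior_exposed F : F `<=` P -> relative_interior F (v i) ->
  F = [set v i].
Proof.
move=> FP [Fi /= near_F]; apply/seteqP; split => x /=; last by move=> ->.
move=> Fx; suff: [set v i] x by []; rewrite -exposed_line; split; last exact: FP.
have [e e0] := near_ray (v i - x) near_F.
have -> : v i + e *: (v i - x) = v i + (- e) *: (x - v i).
  by rewrite scaleNr -scalerN opprB.
move=> /(_ (affine_hull_line (- e) (sub_affine_hull Fi) (sub_affine_hull Fx))).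
move=> /FP /(hull_dot_le exposed_dot_le).
rewrite dotDr gerDl dotZr mulNr oppr_le0 pmulr_rge0// => ge0.
apply/eqP; rewrite eq_le ge0 andbT dotBr subr_le0.
by apply: hull_dot_le (FP _ Fx); exact: exposed_dot_le.
Qed.

End Exposed.

(** A vertex of nonzero weight in a convex combination for [x] also lies on the supporting line,
    hence in the face, which is just [x]. *)
Lemma face0_vertex x : face P 0 [set x] -> range v x.
Proof.
move=> [_ [q [u [[u0 Pq sup] xe]]]].
have [qx Px] : (line q u `&` P) x by rewrite -xe.
(* Replacing [u] by its opposite exchanges the two supporting half-planes. *)
wlog {sup} sup : u u0 xe qx / forall x, P x -> dot u (x - q) <= 0.
  move=> H; case: sup => [|sup]; first exact: H xe qx.
  apply: (H (- u)).
  - by rewrite oppr_eq0.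
  - rewrite xe; congr (_ `&` _); apply/seteqP.
    split => y; rewrite /line /= dotNl; first by move=> ->; rewrite oppr0.
    by move=> /eqP; rewrite oppr_eq0 => /eqP.
  - by move: qx; rewrite /line /= dotNl => ->; rewrite oppr0.
  - by move=> y /sup; rewrite dotNl oppr_le0.
have := Px; move=> /conv_hull_range[a [a0 a1 xa]].
have act : forall i, a i != 0 -> dot u (v i) = dot u q.
  apply: active_dot => //; last first.
    by rewrite -xa; apply/eqP; rewrite -subr_eq0 -dotBr; apply/eqP; exact: qx.
  by move=> i; rewrite -subr_le0 -dotBr; apply: sup; exact: vertex_in_hull.
have [i ai] := sum1_neq0 a1.
exists i => //; suff : [set x] (v i) by [].
rewrite xe; split; last exact: vertex_in_hull.
by rewrite /line /= dotBr act// subrr.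
Qed.

End ConvexPolygon.

(** * Strictly convex polygons with vertices in counterclockwise order *)

Section CyclicPolygon.
Context {R : realType} (n : nat) (v : 'I_n -> 'rV[R]_2) (n_gt2 : (2 < n)%N).
Context (ccw : forall i j, j != i -> j != ordS i ->
  0 < cross (v (ordS i) - v i) (v j - v i)).
Local Notation plane := 'rV[R]_2.
Implicit Types (x y u q : plane) (i j k : 'I_n).

Let P := conv_hull (range v).

Lemma ordS_neq i : ordS i != i.
Proof.
rewrite -val_eqE /=; have := ltn_ord i; rewrite leq_eqVlt => /orP[/eqP h|h].
  by rewrite h modnn; apply/eqP; lia.
by rewrite modn_small//; apply/eqP; lia.
Qed.

Lemma ord_pred_neq i : ord_pred i != i.
Proof. by rewrite -{2}(ord_predK i) eq_sym ordS_neq. Qed.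

Lemma ord_pred_neqS i : ord_pred i != ordS i.
Proof.
apply/eqP => /(congr1 (@ordS n)); rewrite ord_predK => /(congr1 val) /=.
have := ltn_ord i; rewrite leq_eqVlt => /orP[/eqP h|h].
  by rewrite h modnn modn_small//; lia.
rewrite (modn_small h); move: h; rewrite leq_eqVlt => /orP[/eqP h|h].
  by rewrite h modnn; lia.
by rewrite modn_small//; lia.
Qed.

Lemma cross_next_ge0 i j : 0 <= cross (v (ordS i) - v i) (v j - v i).
Proof.
have [->|ji] := eqVneq j i; first by rewrite [cross _ _](_ : _ = 0)// /cross !mxE; ring.
have [->|jSi] := eqVneq j (ordS i); first by rewrite [cross _ _](_ : _ = 0)// /cross !mxE; ring.
exact/ltW/ccw.
Qed.

Lemma cross_prev i j :
  cross (v i - v (ord_pred i)) (v j - v (ord_pred i)) =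
  cross (v j - v i) (v (ord_pred i) - v i).
Proof. by rewrite /cross !mxE; ring. Qed.

Lemma cross_prev_ge0 i j : 0 <= cross (v j - v i) (v (ord_pred i) - v i).
Proof. by rewrite -cross_prev -{1}(ord_predK i) cross_next_ge0. Qed.

Lemma cross_prev_gt0 i j : j != i -> j != ord_pred i ->
  0 < cross (v j - v i) (v (ord_pred i) - v i).
Proof.
by move=> ji jp; rewrite -cross_prev -{1}(ord_predK i) ccw// ord_predK.
Qed.

Lemma cross_next_prev i : 0 < cross (v (ordS i) - v i) (v (ord_pred i) - v i).
Proof. by rewrite ccw ?ord_pred_neq ?ord_pred_neqS. Qed.

(** The chord between the two neighbours, turned by a quarter turn so as to point out of the polygon
    at [v i]. *)
Definition outer_normal i : plane := perp (v (ord_pred i) - v (ordS i)).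

Lemma outer_normal_lt0 i j : j != i -> dot (outer_normal i) (v j - v i) < 0.
Proof.
move=> ji; rewrite dot_perp.
(* The value splits over the two edges at [v i]: both determinants are nonnegative and at most one
   of them vanishes. *)
have -> : cross (v (ord_pred i) - v (ordS i)) (v j - v i) =
   - (cross (v (ordS i) - v i) (v j - v i) + cross (v j - v i) (v (ord_pred i) - v i)).
  by rewrite /cross !mxE; ring.
rewrite oppr_lt0; have [->|jSi] := eqVneq j (ordS i).
  by rewrite ltr_wpDl ?cross_next_ge0// cross_next_prev.
by rewrite ltr_pwDl ?cross_prev_ge0// ccw.
Qed.

Lemma dot_lt0_neq0 u x : dot u x < 0 -> u != 0.
Proof. by apply: contraTneq => ->; rewrite dot0l ltxx. Qed.

Lemma outer_normal_neq0 i : outer_normal i != 0.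
Proof. exact: dot_lt0_neq0 (outer_normal_lt0 (ordS_neq i)). Qed.

Lemma cyclic_convex_polygon : convex_polygon P v.
Proof.
have i0 : 'I_n by exact: (Ordinal (ltnW (ltnW n_gt2))).
split => //.
- by apply: (conv_hull_triangle_interior (cross_next_prev i0)); exact: imageT.
- move=> i j vij; apply/eqP; apply: contraT; rewrite eq_sym => /outer_normal_lt0.
  by rewrite vij subrr dot0r ltxx.
- apply/seteqP; split => x; first exact: face0_vertex.
  move=> [i _ <-]; apply: exposed_face (outer_normal_neq0 i).
  exact: outer_normal_lt0.
Qed.

(** A third vertex on the line of an edge would give two independent directions orthogonal to [u],
    forcing [u = 0]. *)
Lemma active_next_only u (M : R) i k : u != 0 -> dot u (v i) = M ->
  dot u (v (ordS i)) = M -> dot u (v k) = M -> k = i \/ k = ordS i.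
Proof.
move=> u0 ui uSi uk; have [|ki] := eqVneq k i; first by left.
have [|kS] := eqVneq k (ordS i); first by right.
exfalso; move/eqP: u0; apply.
by apply: (dot_ortho_eq0 (lt0r_neq0 (ccw ki kS))); rewrite dotBr ?uSi ?uk ui subrr.
Qed.

(* Seen from v_i, every vertex lies in the cone spanned by the two edges at
   v_i, and strictly inside it unless it is a neighbour of v_i. *)
Lemma active_adjacent u (M : R) i j : u != 0 -> (forall k, dot u (v k) <= M) ->
  dot u (v i) = M -> dot u (v j) = M -> j != i -> j = ordS i \/ i = ordS j.
Proof.
move=> u0 uM ui uj ji.
have [|jS] := eqVneq j (ordS i); first by left.
have [jp|jp] := eqVneq j (ord_pred i); first by right; rewrite jp ord_predK.
exfalso; move/eqP: u0; apply.
have sp := cross_next_prev i; have sy := ccw ji jS; have yp := cross_prev_gt0 ji jp.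
have us : dot u (v (ordS i) - v i) <= 0 by rewrite dotBr ui subr_le0.
have up : dot u (v (ord_pred i) - v i) <= 0 by rewrite dotBr ui subr_le0.
have uy : dot u (v j - v i) = 0 by rewrite dotBr ui uj subrr.
have cramer (s p y : plane) :
    cross s p * dot u y = cross y p * dot u s + cross s y * dot u p.
  by rewrite !dotE /cross; ring.
have := cramer (v (ordS i) - v i) (v (ord_pred i) - v i) (v j - v i).
rewrite uy mulr0 => /esym/eqP; rewrite naddr_eq0 ?pmulr_rle0//.
rewrite !mulf_eq0 (gt_eqF sy) (gt_eqF yp) /= => /andP[/eqP us0 /eqP up0].
exact: dot_ortho_eq0 (lt0r_neq0 sp) us0 up0.
Qed.

(** * Equilibria of a polygon whose center of mass is the origin *)

Section Equilibria.
Context (mean0 : vertex_mean v = 0) (t b : 'I_n).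
(** From one endpoint, the distance to the origin already grows towards the other; so the foot of
    the perpendicular lies strictly outside the edge. *)
Context (edge_foot : forall i, i != b ->
  0 < dot (v (ordS i)) (v i - v (ordS i)) \/ 0 < dot (v i) (v (ordS i) - v i)).
Context (vertex_ascent : forall i, i != t -> exists j, 0 < dot (v i) (v j - v i)).
Context (top_max : forall j, j != t -> dot (v t) (v j - v t) < 0).
Context (bottom_eq : dot (v b) (v b) = dot (v (ordS b)) (v (ordS b))).

(** The endpoints of the bottom edge being equidistant from the origin, its midpoint [m] is the foot
    of the perpendicular and also a normal of the edge. *)
Let d := v (ordS b) - v b.
Let m := 2%:R^-1 *: (v b + v (ordS b)).

Context (bottom_max : forall j, j != b -> j != ordS b -> dot m (v j - v b) < 0).

Lemma vertex_sum0 : \sum_(i < n) v i = 0.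
Proof.
have /eqP := mean0; rewrite /vertex_mean scaler_eq0 invr_eq0 pnatr_eq0.
by rewrite (gtn_eqF (ltnW (ltnW n_gt2))) => /eqP.
Qed.

(** The polygon lies on the origin's side of the line: on the far side all [dot q (v i - q)] would
    be nonnegative, yet, as the vertices sum to zero, they add up to [- n * dot q q]. *)
Lemma equilibrium_dot_le q : equilibrium P 0 q ->
  [/\ q != 0, P q & forall i, dot q (v i) <= dot q q].
Proof.
move=> [_]; rewrite subr0 => -[q0 Pq sup]; split => // i.
case: sup => sup.
  by rewrite -subr_le0 -dotBr; apply: sup; exact: vertex_in_hull.
have : 0 <= \sum_(i < n) dot q (v i - q).
  by apply: sumr_ge0 => j _; apply: sup; exact: vertex_in_hull.
rewrite -dot_sumr sumrB vertex_sum0 sub0r sumr_const card_ord -scaler_nat -scaleNr.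
rewrite dotZr mulNr oppr_ge0 pmulr_rle0 ?ltr0n; last by lia.
by rewrite leNgt dot_gt0.
Qed.

Lemma dot_md : dot m d = 0.
Proof.
have -> : dot m d = 2%:R^-1 * (dot (v (ordS b)) (v (ordS b)) - dot (v b) (v b)).
  by rewrite /m /d !dotE !mxE; ring.
by rewrite bottom_eq subrr mulr0.
Qed.

Lemma v_inj : injective v.
Proof. by have [] := cyclic_convex_polygon. Qed.

Lemma d_neq0 : d != 0.
Proof.
by rewrite /d subr_eq0; apply: contra (ordS_neq b) => /eqP/v_inj/eqP.
Qed.

Lemma vb_m : v b = m + (- 2%:R^-1) *: d.
Proof. by apply: plane_ext; rewrite !mxE; field. Qed.

Lemma vSb_m : v (ordS b) = m + 2%:R^-1 *: d.
Proof. by apply: plane_ext; rewrite !mxE; field. Qed.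

Lemma segment_in_hull (s : R) : - 2%:R^-1 <= s -> s <= 2%:R^-1 -> P (m + s *: d).
Proof.
move=> s0 s1.
have -> : m + s *: d = (2%:R^-1 - s) *: v b + (1 - (2%:R^-1 - s)) *: v (ordS b).
  by apply: plane_ext; rewrite !mxE; field.
by apply: conv_hull_convex; [lra|lra|exact: vertex_in_hull..].
Qed.

Lemma m_in_hull : P m.
Proof. by have := @segment_in_hull 0; rewrite scale0r addr0; apply; lra. Qed.

Lemma m_dot_le j : dot m (v j) <= dot m m.
Proof.
have mb : dot m (v b) = dot m m by rewrite {1}vb_m dotDr (dotZr _ _ d) dot_md mulr0 addr0.
have mSb : dot m (v (ordS b)) = dot m m.
  by rewrite {1}vSb_m dotDr (dotZr _ _ d) dot_md mulr0 addr0.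
have [->|jb] := eqVneq j b; first by rewrite mb.
have [->|jS] := eqVneq j (ordS b); first by rewrite mSb.
by rewrite -mb -subr_le0 -dotBr ltW// bottom_max.
Qed.

Lemma m_neq0 : m != 0.
Proof.
have pb := ord_pred_neq b; have pS := ord_pred_neqS b.
exact: dot_lt0_neq0 (bottom_max pb pS).
Qed.

Lemma top_neq0 : v t != 0.
Proof. exact: dot_lt0_neq0 (top_max (ordS_neq t)). Qed.

(** The vertices of nonzero weight in [q] lie on the supporting line, so there is only one, or two
    adjacent ones. In the first case [q] is a vertex, and [vertex_ascent] makes it the top; in the
    second it is a perpendicular foot inside an edge, which only the bottom edge admits. *)
Lemma equilibriumP q : equilibrium P 0 q -> q = v t \/ q = m.
Proof.
move=> /equilibrium_dot_le[q0 Pq qM].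
have [a [a0 a1 qa]] := conv_hull_range Pq.
have act : forall i, a i != 0 -> dot q (v i) = dot q q.
  by apply: active_dot => //; rewrite -qa.
have [i ai] := sum1_neq0 a1.
have [/existsP[j /andP[ji aj]]|] := boolP [exists j, (j != i) && (a j != 0)]; last first.
  rewrite negb_exists => /forallP h.
  have qi : q = v i.
    rewrite qa; apply: sum_weight1 => // j ji; apply/eqP.
    by have := h j; rewrite ji /= negbK.
  have [it|/vertex_ascent[j]] := eqVneq i t; first by left; rewrite qi it.
  by rewrite -qi dotBr subr_gt0 ltNge qM.
right.
wlog jS : i j ai aj ji / j = ordS i.
  move=> H; have [|] := active_adjacent q0 qM (act _ ai) (act _ aj) ji; first exact: H.
  by apply: H => //; rewrite eq_sym.
have [|aji qij] := @sum_weight2 _ _ v a i j ji _ a1.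
  move=> k ki kj; apply: contraTeq (ki) => ak.
  have [|->|kS] := @active_next_only q (dot q q) i k q0 (act _ ai) _ (act _ ak).
  - by rewrite -jS act.
  - by rewrite eqxx.
  - by rewrite kS jS eqxx in kj.
have qd : dot q (v i - v j) = 0 by rewrite dotBr !act// subrr.
have [lt0i lt0j] : 0 < a i /\ 0 < a j by rewrite !lt0r ai aj !a0.
have dd : 0 < dot (v i - v j) (v i - v j).
  by rewrite dot_gt0// subr_eq0; apply: contra ji => /eqP/v_inj->.
move: qd; rewrite qa qij dotC dotDr !dotZr => qd.
have ddE : dot (v i - v j) (v i) = dot (v i - v j) (v j) + dot (v i - v j) (v i - v j).
  by rewrite -dotDr addrCA subrr addr0.
(* [qd] is a vanishing combination, with positive weights, of the products of the edge direction
   with its endpoints. If the foot is off the edge, both products have the same sign. *)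
have [ib|/edge_foot] := eqVneq i b; last first.
  rewrite -jS [dot (v j) _]dotC [dot (v i) _]dotC => -[h|h]; exfalso.
    suff : 0 < a i * dot (v i - v j) (v i) + a j * dot (v i - v j) (v j).
      by rewrite qd ltxx.
    by rewrite addr_gt0// mulr_gt0// ddE addr_gt0.
  have {}h : dot (v i - v j) (v i) < 0.
    by rewrite -oppr_gt0 -dotNl opprB.
  suff : a i * dot (v i - v j) (v i) + a j * dot (v i - v j) (v j) < 0.
    by rewrite qd ltxx.
  have h' : dot (v i - v j) (v j) < 0 by move: h; rewrite ddE; lra.
  by rewrite -oppr_gt0 opprD -!mulrN addr_gt0// mulr_gt0// oppr_gt0.
(* On the bottom edge the two products are opposite, so both weights are one half. *)
have e : dot (v i - v j) (v i) = - dot (v i - v j) (v j).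
  rewrite jS ib; apply/eqP; rewrite -subr_eq0 opprK -dotDr.
  have := dot_md; rewrite /m /d dotC dotZr => /eqP; rewrite mulf_eq0 invr_eq0.
  by rewrite pnatr_eq0/= -[v b - _]opprB dotNl oppr_eq0.
have neq : dot (v i - v j) (v j) != 0.
  by apply: contraTneq dd => h; move: ddE; rewrite e h oppr0 add0r => <-; rewrite ltxx.
have aij : a j = a i.
  apply: (mulIf neq); apply/eqP; rewrite -subr_eq0 -qd e; apply/eqP; ring.
have ai2 : a i = 2%:R^-1 by move: aji; rewrite aij; lra.
by rewrite aij ai2 -scalerDr jS ib.
Qed.

(** Pushing [q] along itself would raise [dot q] above its maximum over the hull, so [q] is not
    interior. *)
Lemma max_equilibrium q : q != 0 -> P q -> (forall i, dot q (v i) <= dot q q) ->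
  equilibrium P 0 q.
Proof.
move=> q0 Pq qM; have hq x : P x -> dot q x <= dot q q by exact: hull_dot_le.
split; last first.
  by rewrite subr0; split => //; left => x Px; rewrite dotBr subr_le0 hq.
split; first exact: subset_closure.
move=> /(near_ray q)[e e0 /hq]; apply/negP; rewrite -ltNge dotDr ltrDl dotZr.
by rewrite mulr_gt0// dot_gt0.
Qed.

Lemma top_line : line (v t) (v t) `&` P = [set v t].
Proof. exact: exposed_line top_max. Qed.

Lemma top_equilibrium : equilibrium P 0 (v t).
Proof.
apply: max_equilibrium top_neq0 _ _; first exact: vertex_in_hull.
exact: exposed_dot_le top_max.
Qed.

Lemma top_nondegenerate : Defs.nondegenerate P 0 (v t).
Proof.
rewrite /Defs.nondegenerate subr0 top_line; apply/seteqP; split => F /=.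
  move=> [FP]; apply: (relative_interior_exposed top_max).
  by case: FP => -[_ [q [u [_ ->]]]] x [].
move=> ->; split; first by left; exact: exposed_face top_max top_neq0.
split => //=; near=> x.
by rewrite affine_hull_set1.
Unshelve. all: by end_near.
Qed.

Let F0 := line m m `&` P.

Lemma bottom_segment (s : R) : - 2%:R^-1 <= s -> s <= 2%:R^-1 -> F0 (m + s *: d).
Proof.
move=> s0 s1; split; last exact: segment_in_hull.
by rewrite /line /= addrC addKr (dotZr _ _ d) dot_md mulr0.
Qed.

Lemma bottom_line x : line m m x -> x = m + (dot d (x - m) / dot d d) *: d.
Proof.
move=> mx; rewrite -(ortho_scale m_neq0 d_neq0 dot_md mx).
by rewrite addrC subrK.
Qed.

(** [genmx d] packs the row vector [d] into the square matrix that [has_dim] expects. *)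
Lemma bottom_affine_hull : affine_hull F0 = [set x | (x - m <= genmx d)%MS].
Proof.
have F0b : affine_hull F0 (v b).
  by apply: sub_affine_hull; rewrite vb_m; apply: bottom_segment; lra.
have F0Sb : affine_hull F0 (v (ordS b)).
  by apply: sub_affine_hull; rewrite vSb_m; apply: bottom_segment; lra.
apply/seteqP; split.
  apply: affine_hull_sub => x [/bottom_line -> _] /=.
  by rewrite addrC addKr genmxE scalemx_sub.
move=> x /=; rewrite genmxE => /sub_rVP[s xs].
(* The parameter shifts by one half because it is now measured from [v b], half of [d] before
   [m]. *)
have -> : x = v b + (s + 2%:R^-1) *: (v (ordS b) - v b).
  rewrite -/d {1}vb_m -addrA -scalerDl addrCA addNr addr0 -xs.
  by rewrite addrC subrK.
exact: affine_hull_line.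
Qed.

Lemma bottom_dim : has_dim F0 1.
Proof.
exists m, (genmx d); split; last exact: bottom_affine_hull.
by rewrite mxrank_gen rank_rV d_neq0.
Qed.

Lemma bottom_equilibrium : equilibrium P 0 m.
Proof. exact: max_equilibrium m_neq0 m_in_hull m_dot_le. Qed.

Lemma bottom_relative_interior : relative_interior F0 m.
Proof.
split.
  by have := @bottom_segment 0; rewrite scale0r addr0; apply; lra.
have dd := dot_gt0 d_neq0.
(* Together, [up] and [lo] keep [dot d x] within half of [dot d d] of [dot d m]; on the edge line
   this bounds [s] by one half. *)
have up : \forall x \near m, - (dot d d / 2%:R + dot d m) < dot (- d) x.
  by apply: near_dot_gt; rewrite dotNl ltrN2 ltrDr; lra.
have lo : \forall x \near m, dot d m - dot d d / 2%:R < dot d x.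
  by apply: near_dot_gt; lra.
near=> x; rewrite bottom_affine_hull /= genmxE => /sub_rVP[s xs].
have xe : x = m + s *: d by rewrite -xs addrC subrK.
have xup : - (dot d d / 2%:R + dot d m) < dot (- d) x by near: x.
have xlo : dot d m - dot d d / 2%:R < dot d x by near: x.
move: xup xlo; rewrite xe dotNl (dotDr d m) (dotZr _ _ d) => xup xlo.
by apply: bottom_segment; rewrite -(ler_pM2r dd); lra.
Unshelve. all: by end_near.
Qed.

(** The ends of the bottom edge are symmetric about [m] and on one side of any supporting line
    through [m], so such a line is parallel to [d]. *)
Lemma bottom_face_unique F : vertex_or_edge P F -> F m -> F = F0.
Proof.
move=> FP; have {FP} [q [u [[u0 Pq sup] ->]]] :
    exists q u, supports_at P q u /\ F = line q u `&` P.
  by case: FP => -[_].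
move=> [mq _].
have ud : dot u d = 0.
  have um s : dot u (m + s *: d - q) = s * dot u d.
    by rewrite addrAC dotDr mq add0r dotZr.
  have Pb := @vertex_in_hull _ _ v b; have PSb := @vertex_in_hull _ _ v (ordS b).
  by case: sup => sup; have := sup _ Pb; have := sup _ PSb;
    rewrite vb_m vSb_m !um; lra.
rewrite /F0; congr (_ `&` _).
have lineE u1 q1 : u1 != 0 -> dot u1 d = 0 -> line q1 u1 m ->
    line q1 u1 = [set x | exists s : R, x = m + s *: d].
  move=> u10 u1d mq1; apply/seteqP; split => x /=.
    move=> xq1; exists (dot d (x - m) / dot d d).
    rewrite -(ortho_scale u10 d_neq0 u1d) ?(addrC m) ?subrK//.
    have -> : x - m = (x - q1) - (m - q1) by rewrite opprB addrA subrK.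
    by rewrite dotBr xq1 mq1 subrr.
  by move=> [s ->]; rewrite /line /= addrAC dotDr mq1 add0r dotZr u1d mulr0.
rewrite (lineE u)// (lineE m m) ?m_neq0 ?dot_md//.
by rewrite /line /= subrr dot0r.
Qed.

Lemma bottom_face : face P 1 F0.
Proof.
split; first exact: bottom_dim.
exists m, m; split => //; split; [exact: m_neq0|exact: m_in_hull|left => x Px].
by rewrite dotBr subr_le0; apply: hull_dot_le Px; exact: m_dot_le.
Qed.

Lemma bottom_nondegenerate : Defs.nondegenerate P 0 m.
Proof.
rewrite /Defs.nondegenerate subr0 -/F0; apply/seteqP; split => F /=.
  by move=> [FP [Fm _]]; exact: bottom_face_unique.
move=> ->; split; first by right; exact: bottom_face.
exact: bottom_relative_interior.
Qed.

Lemma cyclic_mono_monostatic : mono_monostatic P (vertex_mean v).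
Proof.
rewrite mean0; split.
- move=> q /equilibriumP[] ->; first exact: top_nondegenerate.
  exact: bottom_nondegenerate.
- exists m; split.
    split; [exact: bottom_equilibrium|exact: bottom_nondegenerate|].
    by rewrite subr0; exact: bottom_dim.
  move=> q [/equilibriumP[] -> _ //].
  by rewrite subr0 top_line => /has_dim_set1.
- exists (v t); split.
    split; [exact: top_equilibrium|exact: top_nondegenerate|].
    by rewrite subr0 top_line; exact/has_dim_set1.
  move=> q [/equilibriumP[] -> _ //].
  (* Dimension 0 would identify the two distinct ends of the bottom edge. *)
  rewrite subr0 => F0dim; exfalso.
  have half : - 2%:R^-1 <= (2%:R^-1 : R) by lra.
  have := has_dim0_eq F0dim (bottom_segment (lexx _) half) (bottom_segment half (lexx _)).
  by rewrite -vb_m -vSb_m => /v_inj/esym/eqP; rewrite (negPf (ordS_neq b)).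
Qed.

End Equilibria.
End CyclicPolygon.

(** * Integer coordinates and the explicit 11-gon *)

Section LatticePolygon.
Context {R : realType}.

Definition lattice_point (p : int * int) : 'rV[R]_2 :=
  \row_(k < 2) (if k == 0 then p.1 else p.2)%:~R.

(** Integer counterparts of [dot] and [cross], whose inequalities can be decided by evaluation. *)
Definition zdot (p q : int * int) : int := p.1 * q.1 + p.2 * q.2.

Definition zcross (p q : int * int) : int := p.1 * q.2 - p.2 * q.1.

Lemma dot_lattice p q : dot (lattice_point p) (lattice_point q) = (zdot p q)%:~R.
Proof. by rewrite dotE !mxE /= /zdot; ring. Qed.

Lemma cross_lattice p q : cross (lattice_point p) (lattice_point q) = (zcross p q)%:~R.
Proof. by rewrite /cross !mxE /= /zcross; ring. Qed.

Lemma lattice_pointB p q : lattice_point p - lattice_point q = lattice_point (p - q).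
Proof. by apply: plane_ext; rewrite !mxE /=; ring. Qed.

Lemma lattice_pointD p q : lattice_point p + lattice_point q = lattice_point (p + q).
Proof. by apply: plane_ext; rewrite !mxE /=; ring. Qed.

End LatticePolygon.

(* Each vertex before the bottom edge lies strictly inside the circle whose
   diameter joins the origin to the previous vertex: the polygon is a
   perturbation of Conway's double spiral whose vertices sum to zero. *)
Definition spiral (i : nat) : int * int :=
  nth 0 [:: (0, 36); (-16, 10); (-14, -2); (-10, -7); (-7, -9); (-4, -10);
            (4, -10); (7, -9); (10, -7); (14, -2); (16, 10)] i.

(** Reduces quantification over ordinals to a boolean test on a list of naturals, fit for
    [vm_compute]. *)
Lemma forall_ord_iota n (p : pred nat) : all p (iota 0 n) -> forall i : 'I_n, p i.
Proof. by move=> /allP h i; apply: h; rewrite mem_iota /= ltn_ord. Qed.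

Lemma exists_ord_iota n (p : pred nat) : has p (iota 0 n) -> exists i : 'I_n, p i.
Proof. by move=> /hasP[i]; rewrite mem_iota => /= lt_in pi; exists (Ordinal lt_in). Qed.

Lemma spiral_ccw (i j : 'I_11) : j != i -> j != ordS i ->
  0 < zcross (spiral (ordS i) - spiral i) (spiral j - spiral i).
Proof.
(* [i.+1 %% 11] is the natural number underlying [ordS i]. *)
have /forall_ord_iota/(_ i)/forall_ord_iota/(_ j)/implyP h :
    all (fun i => all (fun j => (j != i) && (j != i.+1 %% 11)%N ==>
      (0 < zcross (spiral (i.+1 %% 11)%N - spiral i) (spiral j - spiral i)))
      (iota 0 11)) (iota 0 11) by vm_compute.
by move=> ji jS; apply: h; rewrite -!val_eqE in ji jS; rewrite ji.
Qed.

Lemma spiral_edge_foot (i : 'I_11) : i != 5 :> nat ->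
  0 < zdot (spiral (ordS i)) (spiral i - spiral (ordS i)) \/
  0 < zdot (spiral i) (spiral (ordS i) - spiral i).
Proof.
have /forall_ord_iota/(_ i)/implyP h : all (fun i => (i != 5) ==>
    (0 < zdot (spiral (i.+1 %% 11)%N) (spiral i - spiral (i.+1 %% 11)%N)) ||
    (0 < zdot (spiral i) (spiral (i.+1 %% 11)%N - spiral i))) (iota 0 11)
  by vm_compute.
by move=> /h/orP.
Qed.

Lemma spiral_ascent (i : 'I_11) : i != 0 :> nat ->
  exists j : 'I_11, 0 < zdot (spiral i) (spiral j - spiral i).
Proof.
have /forall_ord_iota/(_ i)/implyP h : all (fun i => (i != 0) ==>
    has (fun j => 0 < zdot (spiral i) (spiral j - spiral i)) (iota 0 11)) (iota 0 11)
  by vm_compute.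
by move=> /h/exists_ord_iota.
Qed.

Lemma spiral_top (j : 'I_11) : j != 0 :> nat ->
  zdot (spiral 0) (spiral j - spiral 0) < 0.
Proof.
have /forall_ord_iota/(_ j)/implyP // : all (fun j => (j != 0) ==>
    (zdot (spiral 0) (spiral j - spiral 0) < 0)) (iota 0 11) by vm_compute.
Qed.

(** The sum of the endpoints, twice the midpoint, keeps the test integral; the factor one half does
    not affect the sign. *)
Lemma spiral_bottom (j : 'I_11) : j != 5 :> nat -> j != 6 :> nat ->
  zdot (spiral 5 + spiral 6) (spiral j - spiral 5) < 0.
Proof.
have /forall_ord_iota/(_ j)/implyP h : all (fun j => (j != 5) && (j != 6) ==>
    (zdot (spiral 5 + spiral 6) (spiral j - spiral 5) < 0)) (iota 0 11) by vm_compute.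
by move=> j5 j6; apply: h; rewrite j5.
Qed.

Theorem proposition1 (R : realType) :
  exists (P : set 'rV[R]_2) (v : 'I_11 -> 'rV[R]_2),
    convex_polygon P v /\ mono_monostatic P (vertex_mean v).
Proof.
pose v (i : 'I_11) : 'rV[R]_2 := lattice_point (spiral i).
have dotv i j k : dot (v i) (v j - v k) = (zdot (spiral i) (spiral j - spiral k))%:~R.
  by rewrite lattice_pointB dot_lattice.
have ccw i j : j != i -> j != ordS i -> 0 < cross (v (ordS i) - v i) (v j - v i).
  move=> ji jS; rewrite !lattice_pointB cross_lattice ltr0z.
  exact: spiral_ccw.
have mean0 : vertex_mean v = 0.
  rewrite /vertex_mean !big_ord_recl big_ord0 addr0 /v !lattice_pointD.
  by apply: plane_ext; rewrite !mxE /= ; ring.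
exists (conv_hull (range v)), v; split; first exact: cyclic_convex_polygon.
(* Edge 5 is the horizontal one from (-4, -10) to (4, -10); the top (0, 36) has index 0. *)
pose b : 'I_11 := Ordinal (isT : (5 < 11)%N).
apply: (@cyclic_mono_monostatic _ _ v isT ccw mean0 ord0 b).
- by move=> i /spiral_edge_foot; rewrite !dotv !ltr0z.
- by move=> i /spiral_ascent[j h]; exists j; rewrite dotv ltr0z.
- by move=> j /spiral_top; rewrite dotv ltrz0.
- by rewrite !dot_lattice.
- move=> j jb jS; rewrite dotC dotZr dotC pmulr_rlt0 ?invr_gt0//.
  by rewrite lattice_pointD lattice_pointB dot_lattice ltrz0 spiral_bottom.
Qed.
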